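(* Let $X$ be an infinite set. Then $\mathcal{PB}_X$ has the semigroup Bergman property, and $\operatorname{SR}(\mathcal{PB}_X)=2$.
   Context: Partial Brauer monoid. Let $X$ be a set and $X'=\{x':x\in X\}$ a disjoint copy of $X$. A Brauer graph is an (undirected) graph with vertex set $X\cup X'$ in which every vertex has degree at most $1$; $\mathcal{PB}_X$ is the set of all of them. Product: let $X''=\{x'':x\in X\}$ be another disjoint copy of $X$; given $\alpha,\beta\in\mathcal{PB}_X$, let $\alpha^\vee$ be $\alpha$ with each vertex $x'$ renamed $x''$, let $\beta^\wedge$ be $\beta$ with each vertex $x\in X$ renamed $x''$, and let $\Pi(\alpha,\beta)$ be the graph on $X\cup X'\cup X''$ with all edges of $\alpha^\vee$ and $\beta^\wedge$. Then $\alpha\beta$ is the graph on $X\cup X'$ with an edge $\{x,y\}$ whenever $x,y\in X\cup X'$ are distinct and lie in the same connected component of $\Pi(\alpha,\beta)$. This makes $\mathcal{PB}_X$ a monoid with identity the graph with edge set $\{\{x,x'\}:x\in X\}$. The Sierpi\'nski rank $\operatorname{SR}(S)$ of a semigroup $S$ is the least integer $n$ such that every countable subset of $S$ is contained in a subsemigroup of $S$ generated by $n$ elements, if such an $n$ exists; otherwise $\operatorname{SR}(S)=\infty$. A semigroup $S$ has the semigroup Bergman property if every generating set for $S$ has a bounded length function: that is, for every $U\subseteq S$ generating $S$ as a semigroup, there is $N\in\mathbb N$ such that every element of $S$ is a product of at most $N$ elements of $U$. *)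

(* Defs.v *)
From HB Require Import structures.
From Stdlib Require Import Relations.
From mathcomp Require Import all_boot.
From mathcomp Require Import boolp classical_sets functions cardinality.

Set Implicit Arguments.
Unset Strict Implicit.
Unset Printing Implicit Defensive.

Local Open Scope classical_set_scope.
Local Open Scope group_scope.

Section Semigroups.
Variable S : semigroupType.

Definition subsemigroup (A : set S) : Prop :=
  forall x y, A x -> A y -> A (x * y).

Definition generated_by (U : set S) : set S := smallest subsemigroup U.

Definition bounded_length (U : set S) : Prop :=
  exists N : nat, forall s : S, exists (u : S) (us : seq S),
    [/\ size (u :: us) <= N, [set` u :: us] `<=` U & s = foldl *%g u us].

Definition semigroup_Bergman : Prop :=
  forall U : set S, generated_by U = setT -> bounded_length U.

Definition countable_sets_generated (n : nat) : Prop :=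
  forall C : set S, countable C ->
    exists g : n.-tuple S, C `<=` generated_by [set` g].

(* [None] stands for infinity *)
Definition Sierpinski_rank : option nat :=
  match pselect (exists n, `[< countable_sets_generated n >]) with
  | left exn => Some (ex_minn exn)
  | right _ => None
  end.

End Semigroups.

Definition connected (V : Type) (E : relation V) : relation V :=
  clos_refl_trans V E.

Section Graphs.
Variable X : Type.

(* [up x] is the vertex x of X, [dn x] is the vertex x' of X' *)
Variant vertex := up of X | dn of X.

Record brauer := Brauer {
  edge :> relation vertex;
  edge_sym : forall u v, edge u v -> edge v u;
  edge_irr : forall u, ~ edge u u;
  edge_deg : forall u, is_subset1 (edge u) }.

(* [top x], [mid x], [bot x] are the vertices x, x'', x' of the product graph *)
Variant vertex3 := top of X | mid of X | bot of X.

Definition upper (u : vertex) : vertex3 :=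
  match u with up x => top x | dn x => mid x end.

Definition lower (u : vertex) : vertex3 :=
  match u with up x => mid x | dn x => bot x end.

Definition outer (u : vertex) : vertex3 :=
  match u with up x => top x | dn x => bot x end.

Definition relabel (V : Type) (f : vertex -> V) (E : relation vertex) :
    relation V :=
  fun p q => exists u v, [/\ p = f u, q = f v & E u v].

Definition product_graph (a b : brauer) : relation vertex3 :=
  fun p q => relabel upper a p q \/ relabel lower b p q.

Definition mul_edge (a b : brauer) : relation vertex :=
  fun u v => u <> v /\ connected (product_graph a b) (outer u) (outer v).

Definition one_edge : relation vertex :=
  fun u v => exists x, (u = up x /\ v = dn x) \/ (u = dn x /\ v = up x).

End Graphs.

Lemma connected_sym (V : Type) (E : relation V) :
  (forall u v, E u v -> E v u) -> forall u v, connected E u v -> connected E v u.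
Proof.
move=> Es u v; elim=> [x y /Es Eyx|x|x y z _ yx _ zy].
- exact: rt_step.
- exact: rt_refl.
- exact: rt_trans zy yx.
Qed.

Lemma connected_ind (V : Type) (E : relation V) (u : V) (P : V -> Prop) :
  P u -> (forall v w, connected E u v -> P v -> E v w -> P w) ->
  forall v, connected E u v -> P v.
Proof.
move=> Pu Pstep v /(@clos_rt_rtn1 _ _ _ _); elim=> // y z Eyz uy Py.
exact: Pstep (@clos_rtn1_rt _ _ _ _ uy) Py Eyz.
Qed.

Lemma connected_map (V W : Type) (f : V -> W) (E : relation V) (F : relation W) :
  (forall u v, E u v -> connected F (f u) (f v)) ->
  forall u v, connected E u v -> connected F (f u) (f v).
Proof.
move=> EF u v; elim=> [x y /EF//|x|x y z _ xy _ yz].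
- exact: rt_refl.
- exact: rt_trans xy yz.
Qed.

Lemma connected_inj (V W : Type) (f : V -> W) (E : relation V) (F : relation W) :
  injective f -> (forall p q, F p q -> exists u v, [/\ p = f u, q = f v & E u v]) ->
  forall u v, connected F (f u) (f v) -> connected E u v.
Proof.
move=> fI FE u v uq.
suff: exists2 w, f v = f w & connected E u w by move=> [w /fI<-].
move: (f v) uq; apply: connected_ind => [|p q _ [w -> uw]].
  by exists u => //; exact: rt_refl.
move=> /FE[w1 [w2 [/fI<- -> ww2]]]; exists w2 => //.
exact: rt_trans uw (rt_step _ _ _ _ ww2).
Qed.

(* a set I of vertices untouched by the edges of C can be eliminated *)
Lemma connected_elim (V : Type) (A C : relation V) (I : V -> Prop) :
  (forall u v, C u v -> ~ I u /\ ~ I v) ->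
  forall u v, ~ I u -> ~ I v ->
  connected (fun p q => A p q \/ C p q) u v <->
  connected
    (fun p q => [/\ ~ I p, ~ I q, p <> q & connected A p q] \/ C p q) u v.
Proof.
move=> CI u v Iu Iv; split; last first.
  apply: (@connected_map _ _ id) => p q [[_ _ _]|Cpq].
    by apply: (@connected_map _ _ id) => r s Ars; apply: rt_step; left.
  by apply: rt_step; right.
set D := (fun p q => [/\ _, _, _ & _] \/ _).
have AD w t : ~ I w -> ~ I t -> connected A w t -> connected D w t.
  move=> Iw It wt; have [->|wNt] := pselect (w = t); first exact: rt_refl.
  by apply: rt_step; left.
move=> uv; suff: exists w, [/\ ~ I w, connected D u w & connected A w v].
  by move=> [w [Iw uw wv]]; exact: rt_trans uw (AD _ _ Iw Iv wv).
move: v uv {Iv}; apply: connected_ind => [|p q _ [w [Iw uw wp]] [Apq|Cpq]].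
- by exists u; split=> //; exact: rt_refl.
- by exists w; split=> //; exact: rt_trans wp (rt_step _ _ _ _ Apq).
- have [Ip Iq] := CI _ _ Cpq; exists q; split=> //; last exact: rt_refl.
  by apply: rt_trans (rt_trans _ _ _ _ _ uw (AD _ _ Iw Ip wp)) (rt_step _ _ _ _ _); right.
Qed.

Section PartialBrauer.
Variable X : Type.
Implicit Types a b c : brauer X.

Lemma brauerP a b : (forall u v, edge a u v <-> edge b u v) -> a = b.
Proof.
case: a b => [E Es Ei Ed] [F Fs Fi Fd] /= EF.
have {}EF : E = F by apply/funext => u; apply/funext => v; exact/propext.
by case: F / EF Fs Fi Fd => *; congr Brauer; exact: Prop_irrelevance.
Qed.

Lemma upper_inj : injective (@upper X).
Proof. by move=> [x|x] [y|y]//= [->]. Qed.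

Lemma lower_inj : injective (@lower X).
Proof. by move=> [x|x] [y|y]//= [->]. Qed.

Lemma outer_inj : injective (@outer X).
Proof. by move=> [x|x] [y|y]//= [->]. Qed.

Lemma relabel_sym (V : Type) (f : vertex X -> V) a p q :
  relabel f a p q -> relabel f a q p.
Proof. by move=> [u [v [-> -> /edge_sym vu]]]; exists v, u. Qed.

Lemma product_graph_sym a b p q : product_graph a b p q -> product_graph a b q p.
Proof. by case=> pq; [left|right]; exact: relabel_sym. Qed.

Lemma relabel_deg (V : Type) (f : vertex X -> V) a p :
  injective f -> is_subset1 (relabel f a p).
Proof.
move=> fI q r [u [v [-> -> uv]]] [u' [w [/fI<- -> uw]]].
by rewrite (edge_deg uv uw).
Qed.

Lemma mul_edge_sym a b u v : mul_edge a b u v -> mul_edge a b v u.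
Proof.
move=> [uv cuv]; split; first by move=> vu; apply: uv.
by apply: connected_sym cuv; exact: product_graph_sym.
Qed.

Lemma mul_edge_irr a b u : ~ mul_edge a b u u.
Proof. by move=> []. Qed.

(* From an outer vertex, a component of the product graph is a path whose edges
   come alternately from the two factors; [colour true] is the upper factor *)
Let colour a b (k : bool) : relation (vertex3 X) :=
  if k then relabel (@upper X) a else relabel (@lower X) b.

Let start (u : vertex X) : bool := if u is up _ then true else false.

Let colour_deg a b k p : is_subset1 (colour a b k p).
Proof.
by case: k; apply: relabel_deg; [exact: upper_inj|exact: lower_inj].
Qed.

Let colour_sym a b k p q : colour a b k p q -> colour a b k q p.
Proof. by case: k; exact: relabel_sym. Qed.

Let colour_outer a b k u q : colour a b k (outer u) q -> k = start u.
Proof.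
by case: k u => -[x|x] [[y|y] [v []]].
Qed.

Let walk a b u : nat -> vertex3 X -> Prop :=
  fix walk n p := if n is m.+1 then
    exists2 q, walk m q & colour a b (start u (+) odd m) q p
  else p = outer u.

Let walk_fun a b u n : is_subset1 (walk a b u n).
Proof.
elim: n => [p q /= -> ->//|n IHn p q /= [p' wp' p'p] [q' wq' q'q]].
rewrite (IHn _ _ wp' wq') in p'p; exact: colour_deg p'p q'q.
Qed.

Let walk_connected a b u p :
  connected (product_graph a b) (outer u) p -> exists n, walk a b u n p.
Proof.
move: p; apply: connected_ind => [|p q _ [n wp] pq]; first by exists 0.
have [k {}pq] : exists k, colour a b k p q.
  by case: pq; [exists true|exists false].
have [kE|kE] := eqVneq k (start u (+) odd n).
  by exists n.+1; exists p => //; rewrite -kE.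
case: n => [|n] in wp kE *.
  move: pq; rewrite wp => /colour_outer ks.
  by move: kE; rewrite ks /= addbF eqxx.
case: wp => r wr rp; exists n; suff -> : q = r by [].
apply: colour_deg pq _; apply: colour_sym.
suff -> : k = start u (+) odd n by [].
by move: kE => /=; case: k (odd n) (start u) => [] [] [].
Qed.

Let walk_last a b u v n : u <> v -> walk a b u n (outer v) ->
  forall m p, n < m -> ~ walk a b u m p.
Proof.
case: n => [uv /outer_inj vu|n uv wv]; first by case: uv.
have last p : ~ walk a b u n.+2 p.
  move=> [q wq qp]; move: qp; rewrite (@walk_fun a b u n.+1 _ _ wq wv) => /colour_outer /= vE.
  by case: wv => r _ /colour_sym/colour_outer; rewrite -vE; case: (odd n) (start u) => [] [].
elim=> // m IHm p; rewrite ltnS leq_eqVlt => /predU1P[<- //|nm].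
by move=> [q /(IHm _ nm)].
Qed.

Lemma mul_edge_deg a b u : is_subset1 (mul_edge a b u).
Proof.
move=> v w [uv /walk_connected[n wv]] [uw /walk_connected[m ww]].
have [nm|mn|nm] := ltngtP n m.
- by case: (walk_last uv wv nm ww).
- by case: (walk_last uw ww mn wv).
- by rewrite nm in wv; apply: outer_inj; exact: walk_fun wv ww.
Qed.

Definition brauer_mul a b : brauer X :=
  Brauer (@mul_edge_sym a b) (@mul_edge_irr a b) (@mul_edge_deg a b).

Lemma one_edge_sym u v : one_edge u v -> @one_edge X v u.
Proof. by move=> [x [[-> ->]|[-> ->]]]; exists x; [right|left]. Qed.

Lemma one_edge_irr u : ~ @one_edge X u u.
Proof. by move=> [x [[-> //]|[-> //]]]. Qed.

Lemma one_edge_deg u : is_subset1 (@one_edge X u).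
Proof.
by move=> v w [x [[-> ->]|[-> ->]]] [y [[yx ->]|[yx ->]]]; congruence.
Qed.

Definition brauer_one : brauer X :=
  Brauer one_edge_sym one_edge_irr one_edge_deg.

Let connected_brauer a u v : connected a u v -> u = v \/ edge a u v.
Proof.
move: v; apply: connected_ind => [|v w _ [<-|uv] vw]; [by left|by right|left].
by apply: edge_deg vw; exact: edge_sym.
Qed.

Lemma brauer_mul1 : right_id brauer_one brauer_mul.
Proof.
move=> a; apply: brauerP => u v; split=> [[uv uvc]|uv].
  pose f (p : vertex3 X) :=
    match p with top x => up x | mid x => dn x | bot x => dn x end.
  have fo w : f (outer w) = w by case: w.
  suff /connected_brauer[//|] : connected a (f (outer u)) (f (outer v)).
    by rewrite !fo.
  by rewrite !fo.
  apply: connected_map uvc => p q [] [u1 [v1 [-> ->]]].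
    by case: u1 v1 => x [] y; exact: rt_step.
  by move=> [x [[-> ->]|[-> ->]]]; exact: rt_refl.
split; first by move=> uv'; rewrite uv' in uv; exact: edge_irr uv.
have uo w : connected (product_graph a brauer_one) (upper w) (outer w).
  case: w => x; first exact: rt_refl.
  by apply: rt_step; right; exists (up x), (dn x); split=> //; exists x; left.
apply: rt_trans (uo v); apply: rt_trans (rt_step _ _ _ (upper v) _).
  by apply: connected_sym (uo u); exact: product_graph_sym.
by left; exists u, v.
Qed.

Lemma brauer_1mul : left_id brauer_one brauer_mul.
Proof.
move=> a; apply: brauerP => u v; split=> [[uv uvc]|uv].
  pose f (p : vertex3 X) :=
    match p with top x => up x | mid x => up x | bot x => dn x end.
  have fo w : f (outer w) = w by case: w.
  suff /connected_brauer[//|] : connected a (f (outer u)) (f (outer v)).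
    by rewrite !fo.
  by rewrite !fo.
  apply: connected_map uvc => p q [] [u1 [v1 [-> ->]]].
    by move=> [x [[-> ->]|[-> ->]]]; exact: rt_refl.
  by case: u1 v1 => x [] y; exact: rt_step.
split; first by move=> uv'; rewrite uv' in uv; exact: edge_irr uv.
have ou w : connected (product_graph brauer_one a) (lower w) (outer w).
  case: w => x; last exact: rt_refl.
  by apply: rt_step; left; exists (dn x), (up x); split=> //; exists x; right.
apply: rt_trans (ou v); apply: rt_trans (rt_step _ _ _ (lower v) _).
  by apply: connected_sym (ou u); exact: product_graph_sym.
by right; exists u, v.
Qed.

(* associativity: the factors are laid out on the levels of [nat * X] *)
Let place (i j : nat) (u : vertex X) : nat * X :=
  match u with up x => (i, x) | dn x => (j, x) end.

Let layers (i j k : nat) (p : vertex3 X) : nat * X :=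
  match p with top x => (i, x) | mid x => (j, x) | bot x => (k, x) end.

Let stack i j k a b : relation (nat * X) :=
  fun p q => relabel (place i j) a p q \/ relabel (place j k) b p q.

Let stackP i j k a b p q : i != j -> j != k -> i != k ->
  connected (stack i j k a b) (layers i j k p) (layers i j k q) <->
  connected (product_graph a b) p q.
Proof.
move=> /eqP ij /eqP jk /eqP ik; split.
  apply: connected_inj => [[x|x|x] [y|y|y] []|r s [] [u [v [-> -> uv]]]].
  all: try by [move=> // *; congruence].
    exists (upper u), (upper v); split; [by case: u {uv}|by case: v {uv}|].
    by left; exists u, v.
  exists (lower u), (lower v); split; [by case: u {uv}|by case: v {uv}|].
  by right; exists u, v.
apply: connected_map => r s [] [u [v [-> -> uv]]]; apply: rt_step.
  by left; exists u, v; split=> //; [case: u {uv}|case: v {uv}].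
by right; exists u, v; split=> //; [case: u {uv}|case: v {uv}].
Qed.

Let stack_sym i j k a b p q : stack i j k a b p q -> stack i j k a b q p.
Proof. by case=> pq; [left|right]; exact: relabel_sym. Qed.

Let stack_level i j k a b p q : connected (stack i j k a b) p q -> p <> q ->
  p.1 <> j -> q.1 <> j -> exists2 u, p = place i k u & exists v, q = place i k v.
Proof.
have H r s : connected (stack i j k a b) r s -> r <> s -> s.1 <> j ->
    exists v, s = place i k v.
  move=> rs; have : r = s \/ exists t, s = layers i j k t.
    move: s rs; apply: connected_ind; first by left.
    move=> _ _ _ _ [] [u [v [_ -> _]]]; right.
      by exists (upper v); case: v.
    by exists (lower v); case: v.
  by case=> // -[[x|x|x] ->] _ // _; [exists (up x)|exists (dn x)].
move=> pq pNq pj qj; have [v qE] := H _ _ pq pNq qj.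
have qNp : q <> p by move=> qp; apply: pNq.
have [u pE] := H _ _ (connected_sym (@stack_sym i j k a b) pq) qNp pj.
by exists u => //; exists v.
Qed.

Let place_inj i k : i != k -> injective (place i k).
Proof. by move=> /eqP ik [x|x] [y|y] [] // *; congruence. Qed.

Let place_mul i j k a b p q : i != j -> j != k -> i != k ->
  relabel (place i k) (brauer_mul a b) p q <->
  [/\ p.1 <> j, q.1 <> j, p <> q & connected (stack i j k a b) p q].
Proof.
move=> ij jk ik; have lo w : layers i j k (outer w) = place i k w by case: w.
have pj w : (place i k w).1 <> j.
  by case: w => x /= /eqP; [rewrite (negbTE ij)|rewrite eq_sym (negbTE jk)].
split=> [[u [v [-> -> [uv cuv]]]]|[pNj qNj pq cpq]].
  split=> //; first by move/(place_inj ik).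
  by rewrite -!lo; apply/stackP.
have [u pE [v qE]] := stack_level cpq pq pNj qNj.
exists u, v; split=> //; split=> [uv|].
  by apply: pq; rewrite pE qE uv.
by apply/(stackP _ _ _ _ ij jk ik); rewrite !lo -pE -qE.
Qed.

Let eq_connected (V : Type) (E F : relation V) u v :
  (forall p q, E p q <-> F p q) -> connected E u v <-> connected F u v.
Proof.
by move=> EF; have -> : E = F by apply/funext => p; apply/funext => q; exact/propext.
Qed.

Let relabel_level i j l a p q : l != i -> l != j ->
  relabel (place i j) a p q -> p.1 <> l /\ q.1 <> l.
Proof.
by move=> /eqP li /eqP lj [[x|x] [[y|y] [-> -> _]]]; split=> /= E; congruence.
Qed.

Lemma brauer_mulA : associative brauer_mul.
Proof.
move=> a b c; apply: brauerP => u v.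
pose G := fun p q => relabel (place 0 1%N) a p q
  \/ relabel (place 1%N 2) b p q \/ relabel (place 2 3) c p q.
have lo j w : layers 0 j 3 (outer w) = place 0 3 w by case: w.
have NI j w : j != 0 -> j != 3 -> (place 0 3 w).1 <> j.
  by case: w => x /= /eqP j0 /eqP j3; congruence.
suff [HL HR] : (connected (product_graph a (brauer_mul b c)) (outer u) (outer v)
         <-> connected G (place 0 3 u) (place 0 3 v)) /\
       (connected (product_graph (brauer_mul a b) c) (outer u) (outer v)
         <-> connected G (place 0 3 u) (place 0 3 v)).
  by split=> -[uv cuv]; split=> //; [apply/HR/HL|apply/HL/HR].
have Gl p q : G p q <->
    stack 1%N 2 3 b c p q \/ relabel (place 0 1%N) a p q.
  by rewrite /G /stack; tauto.
have Gr p q : G p q <->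
    stack 0 1%N 2 a b p q \/ relabel (place 2 3) c p q.
  by rewrite /G /stack; tauto.
split.
- have E1 := eq_connected (place 0 3 u) (place 0 3 v) Gl.
  have E2 := @connected_elim _ (stack 1%N 2 3 b c) (relabel (place 0 1%N) a)
    (fun p => p.1 = 2) (fun p q => @relabel_level 0 1%N 2 a p q isT isT) _ _
    (NI 2 u isT isT) (NI 2 v isT isT).
  have := @stackP 0 1%N 3 a (brauer_mul b c) (outer u) (outer v) isT isT isT.
  rewrite !lo => E0; apply: (iff_trans (iff_sym E0)).
  apply: (iff_trans _ (iff_sym E1)); apply: (iff_trans _ (iff_sym E2)).
  apply: eq_connected => p q; have := @place_mul 1%N 2 3 b c p q isT isT isT.
  by rewrite /stack; tauto.
- have E1 := eq_connected (place 0 3 u) (place 0 3 v) Gr.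
  have E2 := @connected_elim _ (stack 0 1%N 2 a b) (relabel (place 2 3) c)
    (fun p => p.1 = 1%N) (fun p q => @relabel_level 2 3 1%N c p q isT isT) _ _
    (NI 1%N u isT isT) (NI 1%N v isT isT).
  have := @stackP 0 2 3 (brauer_mul a b) c (outer u) (outer v) isT isT isT.
  rewrite !lo => E0; apply: (iff_trans (iff_sym E0)).
  apply: (iff_trans _ (iff_sym E1)); apply: (iff_trans _ (iff_sym E2)).
  apply: eq_connected => p q; have := @place_mul 0 1%N 2 a b p q isT isT isT.
  by rewrite /stack; tauto.
Qed.

End PartialBrauer.

HB.instance Definition _ (X : Type) := gen_eqMixin (brauer X).
HB.instance Definition _ (X : Type) := gen_choiceMixin (brauer X).
HB.instance Definition _ (X : Type) := isMonoid.Build (brauer X)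
  (@brauer_mulA X) (@brauer_1mul X) (@brauer_mul1 X).

(* Main.v *)
Require Import Defs.
From Stdlib Require Import Relations.
From mathcomp Require Import all_boot.
From mathcomp Require Import boolp classical_sets functions cardinality.

Set Implicit Arguments.
Unset Strict Implicit.
Unset Printing Implicit Defensive.

Local Open Scope classical_set_scope.
Local Open Scope group_scope.

(** The whole theorem rests on one solvability property of the monoid M of
    partial Brauer graphs: there are fixed b and c in M such that for every
    sequence t of elements of M some a satisfies a c^n b = t_n for all n
    ([store_nth]).

    Given this, take t_0 = c: the equation for n = 0 reads a b = c, so c is
    itself a product of a and b, and t_n = a (a b)^n b.  Every sequence in M
    thus lies in a subsemigroup with two generators, its n-th term being a word
    whose length depends on n alone ([two_generators]).  This gives both
    conclusions.  Countable sets lie in 2-generated subsemigroups.  If a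
    generating set U had unbounded length, one could choose the n-th term to be
    longer, with respect to U, than any product of that shape whose factors a
    and b have length at most n; but a and b have some finite length n.  One
    generator is not enough because M is not commutative: otherwise, with
    t_0 = 1 and t_1 = s, we get c = c a b = a c b = s for all s.

    To find b and c, embed in X, by an injection [slot], the disjoint union of
    X and of countably many copies of the vertex set of a Brauer graph; this is
    possible because X x nat embeds in X ([prod_nat_inj]).  The graph a
    sends the vertices x of X to the slots of the first part, and carries
    t_0, t_1, ... as edges between its lower vertices, in the slots of the
    second part.  The graph b glues the slot of x to the vertex x of the 0-th
    copy by an edge between upper vertices, and sends the vertex x' of that
    copy out to x': composing a with b, paths run through the stored t_0.  The
    graph c moves each copy down by one and drops the 0-th one. *)

(** * An infinite set absorbs a product with nat *)

(** By Zorn's lemma there is a maximal family F of injections nat -> X with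
    disjoint ranges.  What these ranges miss is finite, and is coded along one
    member f0 of F; every other point is a pair of a member of F and a
    natural number, and nat * nat embeds in nat. *)
Lemma prod_nat_inj (X : Type) : infinite_set [set: X] ->
  exists e : X * nat -> X, injective e.
Proof.
move=> Xinf.
(* taking f = g gives the injectivity of f, and f <> g disjoint ranges *)
pose jinj (F : set (nat -> X)) := forall f g m n, F f -> F g -> f m = g n ->
  f = g /\ m = n.
have [|F [jF Fmax]] := @Zorn_bigcup _ jinj.
  move=> C CP Ctot f g m n [A CA Af] [B CB Bg].
  have [AB|BA] := Ctot _ _ CA CB; last exact: (CP A) (BA _ Bg).
  exact: (CP B) (AB _ Af) _.
pose R := [set x | forall f n, F f -> f n <> x].
have Rfin : finite_set R.
  apply: contrapT => /infiniteP/card_leP[g].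
  pose h n := val (g (SigSub (mem_set (I : [set: nat] n)))).
  have hR n : R (h n) by exact: set_valP.
  have hI : injective h by move=> m n /val_inj/inj; rewrite !inE => /(_ I I)[].
  apply: (Fmax (F `|` [set h])).
    split; first by move=> f Ff; left.
    move=> /(_ h (or_intror erefl)) Fh.
    exact: (hR 0 h 0 Fh erefl).
  move=> f k m n [Ff|->] [Fk|->].
  - exact: jF.
  - by move=> fh; case: (hR n f m Ff).
  - by move=> /esym fh; case: (hR m k n Fk).
  - by move=> /hI.
have [f0 Ff0] : exists f, F f.
  apply: contrapT => F0; apply: Xinf; apply: sub_finite_set Rfin => x _ f n Ff.
  by case: F0; exists f.
have /countable_injP[r rI] := finite_set_countable Rfin.
(* the code of x: the member of F on which x is stored, and its index there *)
have /choice[k kP] (x : X) : exists k : (nat -> X) * (nat + nat), F k.1 /\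
    ((R x /\ k = (f0, inl (r x))) \/ exists2 n, k = (k.1, inr n) & k.1 n = x).
  have [Rx|/existsNP[f /existsNP[n /not_implyP[Ff /contrapT fn]]]] := pselect (R x).
    by exists (f0, inl (r x)); split=> //; left.
  by exists (f, inr n); split=> //; right; exists n.
have kI : injective k.
  move=> x y kxy; have [_ kx] := kP x; have [_ ky] := kP y.
  case: kx => [[Rx kx]|[m kx xm]]; case: ky => [[Ry ky]|[n ky yn]].
  - by move: kxy; rewrite kx ky => -[/rI]; apply; exact: mem_set.
  - by exfalso; congruence.
  - by exfalso; congruence.
  - have mn : m = n by congruence.
    by congruence.
exists (fun p => (k p.1).1 (pickle ((k p.1).2, p.2))) => -[x m] [y n] /=.
move=> /(jF _ _ _ _ (kP x).1 (kP y).1)[k1 /(pcan_inj pickleK)[k2 ->]].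
by congr (_, _); apply: kI; rewrite (surjective_pairing (k x)) k1 k2 -surjective_pairing.
Qed.

(** * Words and generated subsemigroups *)

Section Words.
Context {S : semigroupType}.
Implicit Types (U : set S) (x y : S).

Definition word_le U (n : nat) x := exists (u : S) (us : seq S),
  [/\ (size (u :: us) <= n)%N, [set` u :: us] `<=` U & x = foldl *%g u us].

Lemma foldl_mulA x y (us : seq S) : foldl *%g (x * y) us = x * foldl *%g y us.
Proof. by elim: us y => //= u us IH y; rewrite -mulgA IH. Qed.

Lemma word_le1 U x : U x -> word_le U 1%N x.
Proof. by move=> Ux; exists x, [::]; split=> // y /=; rewrite inE => /eqP->. Qed.

Lemma word_le_mono U m n x : (m <= n)%N -> word_le U m x -> word_le U n x.
Proof. by move=> mn [u [us [us_m usU ->]]]; exists u, us; split=> //; exact: leq_trans mn. Qed.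

Lemma word_leM U (m n : nat) x y :
  word_le U m x -> word_le U n y -> word_le U (m + n)%N (x * y).
Proof.
move=> [u [us [us_m usU ->]]] [v [vs [vs_n vsU ->]]]; exists u, (us ++ v :: vs).
split; first by rewrite /= size_cat -addSn leq_add.
  move=> z /=; rewrite -cat_cons mem_cat => /orP[]; [exact: usU|exact: vsU].
by rewrite foldl_cat /= foldl_mulA.
Qed.

Lemma generated_word U x : generated_by U x -> exists n, word_le U n x.
Proof.
move=> /(_ [set x | exists n, word_le U n x]); apply; split=> [y z [m my] [n nz]|y Uy].
  by exists (m + n)%N; exact: word_leM.
by exists 1%N; exact: word_le1.
Qed.

Lemma generated_incl U x : U x -> generated_by U x.
Proof. by move=> Ux A [_]; apply. Qed.

Lemma generated_subsemigroup U : subsemigroup (generated_by U).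
Proof. by move=> x y Ux Uy A AP; apply: AP.1; [exact: Ux|exact: Uy]. Qed.

(** The centralizer of x is a subsemigroup. *)
Lemma generated_centralized U x :
  U `<=` [set y | commute x y] -> generated_by U `<=` [set y | commute x y].
Proof.
move=> Ux y; apply; split=> // z w xz xw.
by rewrite /= /commute mulgA xz -mulgA xw mulgA.
Qed.

Lemma generated_commute U :
  (forall x y, U x -> U y -> commute x y) ->
  forall x y, generated_by U x -> generated_by U y -> commute x y.
Proof.
move=> UU x y Ux; apply: generated_centralized => z Uz.
apply/commute_sym; apply: generated_centralized Ux => w; exact: UU.
Qed.

End Words.

Lemma subsemigroup_pow (S : monoidType) (A : set S) x n :
  subsemigroup A -> A x -> A (x ^+ n.+1).
Proof.
by move=> AS Ax; elim: n => [|n IHn]; [rewrite expg1|rewrite expgS; exact: AS].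
Qed.

(** * Monoids in which the equations a c^n b = t_n can be solved for a *)

Section Universal.
Context {S : monoidType} (b c : S).
Hypothesis solve : forall t : nat -> S, exists a, forall n, a * c ^+ n * b = t n.

(** The sequence solved for is c, s_0, s_1, ...: the equation at 0 is a b = c,
    and eliminates c from the others. *)
Lemma two_generators (s : nat -> S) :
  exists a, forall n, s n = a * (a * b) ^+ n.+1 * b.
Proof.
have [a aP] := solve (fun n => if n is m.+1 then s m else c).
by exists a => n; have /= := aP 0%N; rewrite mulg1 => ->; rewrite (aP n.+1).
Qed.

(** The elements s_n are chosen too long to be the words of [two_generators] in
    factors of length at most n; taking for n a common bound on the lengths of
    a and b gives the contradiction. *)
Lemma semigroup_Bergman_of : semigroup_Bergman S.
Proof.
move=> U genU; apply: contrapT => unb.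
have /choice[s sN] (n : nat) : exists x, ~ word_le U (n + n.+1 * (n + n) + n)%N x.
  apply: contrapT => /forallNP sN; apply: unb; exists (n + n.+1 * (n + n) + n)%N => x.
  exact: contrapT (sN x).
have [a sE] := two_generators s.
have [k ak] : exists k, word_le U k a by apply: generated_word; rewrite genU.
have [l bl] : exists l, word_le U l b by apply: generated_word; rewrite genU.
pose n := (k + l)%N.
have an : word_le U n a by apply: word_le_mono ak; exact: leq_addr.
have bn : word_le U n b by apply: word_le_mono bl; exact: leq_addl.
have pow m : word_le U (m.+1 * (n + n))%N ((a * b) ^+ m.+1).
  elim: m => [|m IHm]; first by rewrite mul1n expg1; exact: word_leM.
  by rewrite expgS mulSn; exact: word_leM (word_leM an bn) IHm.
apply: (sN n); rewrite sE.
exact: word_leM (word_leM an (pow n)) bn.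
Qed.

Lemma countable_sets_generated2 : countable_sets_generated S 2.
Proof.
move=> C /countable_injP[f fI].
have /choice[s sP] (n : nat) : exists s, forall x, C x -> f x = n -> s = x.
  have [[x [Cx fx]]|nex] := pselect (exists x, C x /\ f x = n).
    by exists x => y Cy fy; apply: fI; rewrite ?fx ?fy//; exact: mem_set.
  by exists 1 => x Cx fx; case: nex; exists x.
have [a sE] := two_generators s; exists [tuple a; b] => x Cx.
have ga : generated_by [set` [tuple a; b]] a.
  by apply: generated_incl; rewrite /= !inE eqxx.
have gb : generated_by [set` [tuple a; b]] b.
  by apply: generated_incl; rewrite /= !inE eqxx orbT.
have gM := @generated_subsemigroup _ [set` [tuple a; b]].
rewrite -(sP _ x Cx erefl) sE; apply: (gM _ _ _ gb); apply: (gM _ _ ga).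
apply: (@subsemigroup_pow S (generated_by [set` [tuple a; b]]) (a * b)) => [|].
  exact: gM.
exact: gM ga gb.
Qed.

(** In a commutative monoid the solution a of t_0 = 1, t_1 = s would give
    c = c (a b) = a c b = s for every s, so that only one element could exist. *)
Lemma noncommuting (d : S) : d <> 1 -> exists x y : S, ~ commute x y.
Proof.
move=> d1; apply: contrapT => nex.
have comm (x y : S) : commute x y.
  by apply: contrapT => nxy; apply: nex; exists x, y.
have cE (s : S) : c = s.
  have [a aP] := solve (fun n => if n is 0%N then 1 else s).
  have /= <- := aP 1%N; have /= := aP 0%N.
  by rewrite expg1 mulg1 (comm a c) -mulgA => ->; rewrite mulg1.
by apply: d1; rewrite -(cE d) -(cE 1).
Qed.

Lemma Sierpinski_rank_of (d : S) : d <> 1 -> Sierpinski_rank S = Some 2.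
Proof.
move=> /noncommuting[x [y xy]].
have gt1 n : countable_sets_generated S n -> (1 < n)%N.
  move=> genn; rewrite ltnNge; apply/negP => n1; apply: xy.
  have [] := genn [set x; y]; first exact/finite_set_countable/finite_set2.
  move=> g gC; have gx := gC x (or_introl erefl); have gy := gC y (or_intror erefl).
  apply: (generated_commute _ gx gy) => {gx gy gC} u v.
  change (u \in tval g -> v \in tval g -> commute u v).
  case: (tval g) (size_tuple g) => [|z [|? ?]] //=; last by case: n {genn g} n1 => [|[]].
  by rewrite !inE => _ /eqP-> /eqP->.
rewrite /Sierpinski_rank; case: pselect => [exn|[]]; last first.
  by exists 2; apply/asboolP; exact: countable_sets_generated2.
congr Some; case: ex_minnP => n /asboolP/gt1 n1 nmin.
by apply/eqP; rewrite eqn_leq n1 andbT; apply/nmin/asboolP/countable_sets_generated2.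
Qed.

End Universal.

(** * Products of Brauer graphs *)

Section Graphs.
Context {X : Type}.
Implicit Types d : brauer X.

(** Edges given with an orientation; [brauer_of] forgets it. *)
Record matching (R : relation (vertex X)) : Prop := Matching {
  matching_irr : forall u, ~ R u u;
  matching_out : forall u v w, R u v -> R u w -> v = w;
  matching_in : forall u v w, R v u -> R w u -> v = w;
  matching_through : forall u v w, R u v -> R v w -> u = w }.

Definition brauer_of {R : relation (vertex X)} (mR : matching R) : brauer X.
Proof.
exists (fun u v => R u v \/ R v u).
- by move=> u v [uv|uv]; [right|left].
- by move=> u [|]; exact: matching_irr.
- move=> u v w [uv|vu] [uw|wu].
  + exact: matching_out uv uw.
  + by rewrite (matching_through mR wu uv).
  + exact: matching_through vu uw.
  + exact: matching_in vu wu.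
Defined.

(** To compute a product, label the vertices of the product graph by vertices
    of the expected result d, or by [None] for those in components that do not
    meet the outer vertices, in such a way that outer vertices keep their names
    and each edge either preserves the label or follows an edge of d.  As d has
    degree at most 1, a component then meets at most the two ends of an edge of
    d, so that no edge other than those of d can appear. *)
Lemma brauer_mul_labelled {R Q : relation (vertex X)} (mR : matching R)
    (mQ : matching Q) d (r : vertex3 X -> option (vertex X)) :
  let compatible p q :=
    r p = r q \/ exists u v, [/\ r p = Some u, r q = Some v & edge d u v] in
  (forall u, r (outer u) = Some u) ->
  (forall u v, R u v -> compatible (upper u) (upper v)) ->
  (forall u v, Q u v -> compatible (lower u) (lower v)) ->
  (forall u v, edge d u v ->
    connected (product_graph (brauer_of mR) (brauer_of mQ)) (outer u) (outer v)) ->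
  brauer_of mR * brauer_of mQ = d.
Proof.
move=> compatible ro rR rQ dP; apply: brauerP => u v; split=> [[uv cuv]|duv]; last first.
  split; last exact: dP.
  by move=> uv; rewrite uv in duv; exact: edge_irr duv.
have compC p q : compatible p q -> compatible q p.
  case=> [rpq|[x [y [rp rq xy]]]]; first by left.
  by right; exists y, x; split=> //; exact: edge_sym.
have rP p q : product_graph (brauer_of mR) (brauer_of mQ) p q -> compatible p q.
  by case=> -[x [y [-> -> []]]] => [/rR|/rR/compC|/rQ|/rQ/compC].
pose P p := r p = Some u \/ exists2 w, r p = Some w & edge d u w.
suff : P (outer v) by rewrite /P ro => -[[vu]|[w [->]]] //; case: uv.
apply: (connected_ind (P := P) _ _ cuv) => [|p q _ IH pq]; first by left.
have [rpq|[x [y [rp rq xy]]]] := rP _ _ pq; first by rewrite /P -rpq.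
rewrite /P rq; move: IH; rewrite /P rp => -[[xu]|[w [xw] uw]].
  by right; exists y => //; rewrite -xu.
by left; congr Some; rewrite -xw in uw; exact: edge_deg xy (edge_sym uw).
Qed.

Lemma step_upper {R Q : relation (vertex X)} {mR : matching R}
    {mQ : matching Q} {u v} : R u v ->
  connected (product_graph (brauer_of mR) (brauer_of mQ)) (upper u) (upper v).
Proof. by move=> uv; apply: rt_step; left; exists u, v; split=> //; left. Qed.

Lemma step_lower {R Q : relation (vertex X)} {mR : matching R}
    {mQ : matching Q} {u v} : Q u v ->
  connected (product_graph (brauer_of mR) (brauer_of mQ)) (lower u) (lower v).
Proof. by move=> uv; apply: rt_step; right; exists u, v; split=> //; left. Qed.

End Graphs.

(** * Storing a sequence of Brauer graphs in one *)

Section Storage.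
Context {X : Type} (slot : X + nat * vertex X -> X) (slotI : injective slot).
Implicit Types t : nat -> brauer X.

Notation port z := (slot (inl z)).
Notation cell n u := (slot (inr (n, u))).

(** An edge of [t n] becomes an edge between two primed vertices, whether its
    ends are primed or not. *)
Variant store_edge t : relation (vertex X) :=
  | store_port z : store_edge t (up z) (dn (port z))
  | store_cell n u v of edge (t n) u v : store_edge t (dn (cell n u)) (dn (cell n v)).

Variant shift_edge : relation (vertex X) :=
  | shift_port z : shift_edge (up (port z)) (dn (port z))
  | shift_cell n u : shift_edge (up (cell n.+1 u)) (dn (cell n u)).

Variant read_edge : relation (vertex X) :=
  | read_in z : read_edge (up (port z)) (up (cell 0 (up z)))
  | read_out z : read_edge (up (cell 0 (dn z))) (dn z).

Ltac edges :=
  repeat match goal with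
  | |- forall _, _ => intro
  | |- ~ _ => intro
  | H : store_edge _ _ _ |- _ => inversion H; clear H
  | H : shift_edge _ _ |- _ => inversion H; clear H
  | H : read_edge _ _ |- _ => inversion H; clear H
  end; subst;
  repeat match goal with
  | H : up _ = up _ |- _ => injection H; clear H; intro
  | H : dn _ = dn _ |- _ => injection H; clear H; intro
  | H : slot _ = slot _ |- _ => apply slotI in H
  | H : inr _ = inr _ |- _ => injection H; clear H; intros
  | H : inl _ = inl _ |- _ => injection H; clear H; intros
  end; subst; try congruence.

Lemma store_matching t : matching (store_edge t).
Proof.
split; edges.
- by match goal with H : edge _ _ _ |- _ => case: (edge_irr H) end.
- by match goal with H : edge _ ?u _, K : edge _ ?u _ |- _ => rewrite (edge_deg H K) end.
- by match goal with H : edge _ _ ?u, K : edge _ _ ?u |- _ =>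
    rewrite (edge_deg (edge_sym H) (edge_sym K)) end.
- by match goal with H : edge _ _ ?u, K : edge _ ?u _ |- _ =>
    rewrite (edge_deg (edge_sym H) K) end.
Qed.

Lemma shift_matching : matching shift_edge.
Proof. by split; edges. Qed.

Lemma read_matching : matching read_edge.
Proof. by split; edges. Qed.

Definition store t := brauer_of (store_matching t).
Definition shift := brauer_of shift_matching.
Definition read := brauer_of read_matching.

Let label (x : X) : option (X + nat * vertex X) :=
  if pselect (exists l, slot l = x) is left e then Some (projT1 (cid e)) else None.

Let labelK l : label (slot l) = Some l.
Proof.
rewrite /label; case: pselect => [e|[]]; last by exists l.
by case: cid => k /= /slotI->.
Qed.

(** The vertex x of X is joined, through its port, to the vertex x of the 0-th
    cell, and x' directly to the vertex x' there: between these ends the product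
    graph shows the edges of [t 0].  The other cells lie in components with
    no outer vertex. *)
Lemma store_read t : store t * read = t 0%N.
Proof.
pose r p := match p with
  | top z => Some (up z)
  | mid x => match label x with
    | Some (inl z) => Some (up z)
    | Some (inr (0, u)) => Some u
    | _ => None
    end
  | bot z => Some (dn z)
  end.
apply: (brauer_mul_labelled (r := r)) => [[]//|||u v uv].
- move=> _ _ [z|n u v uv] /=; rewrite /r !labelK; first by left.
  by case: n uv => [|n] uv; [right; exists u, v|left].
- by move=> _ _ [z|z]; left; rewrite /r /= !labelK.
set G := product_graph _ _.
have toMid w : connected G (outer w) (mid (cell 0 w)).
  case: w => z.
    exact: rt_trans (step_upper (store_port t z)) (step_lower (read_in z)).
  apply: connected_sym; first exact: product_graph_sym.
  exact: (step_lower (read_out z)).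
apply: rt_trans (toMid u) _; apply: rt_trans (step_upper (store_cell uv)) _.
apply: connected_sym (toMid v); exact: product_graph_sym.
Qed.

(** The 0-th cell is dropped: [shift] has no edge at its vertices. *)
Lemma store_shift t : store t * shift = store (fun n => t n.+1).
Proof.
pose r p := match p with
  | top z => Some (up z)
  | mid x => match label x with
    | Some (inl z) => Some (up z)
    | Some (inr (n.+1, u)) => Some (dn (cell n u))
    | _ => None
    end
  | bot z => Some (dn z)
  end.
apply: (brauer_mul_labelled (r := r)) => [[]//|||u v uv].
- move=> _ _ [z|n u v uv]; rewrite /r /= !labelK; first by left.
  case: n uv => [|n] uv; [by left|right; exists (dn (cell n u)), (dn (cell n v))].
  by split=> //; left; apply: store_cell.
- move=> _ _ [z|n u]; rewrite /r /= !labelK; last by left.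
  by right; exists (up z), (dn (port z)); split=> //; left; apply: store_port.
set G := product_graph _ _.
have GC : forall p q, connected G p q -> connected G q p.
  by apply: connected_sym; exact: product_graph_sym.
have down n w : connected G (mid (cell n.+1 w)) (bot (cell n w)).
  exact: (step_lower (shift_cell n w)).
have half x y : store_edge (fun n => t n.+1) x y -> connected G (outer x) (outer y).
  case=> [z|n x' y' xy].
    exact: rt_trans (step_upper (store_port t z)) (step_lower (shift_port z)).
  apply: rt_trans (GC _ _ (down n x')) _; apply: rt_trans (down n y').
  exact: (step_upper (@store_cell t n.+1 _ _ xy)).
by case: uv => [/half//|/half/GC].
Qed.

Lemma store_nth t n : store t * shift ^+ n * read = t n.
Proof.
elim: n t => [|n IHn] t; first by rewrite expg0 mulg1 store_read.
by rewrite expgS mulgA store_shift IHn.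
Qed.

End Storage.

(** * Partial Brauer graphs on an infinite set *)

Definition empty_brauer (X : Type) : brauer X :=
  brauer_of (@Matching X (fun _ _ => False) (fun _ => id)
    (fun _ _ _ (f : False) _ => match f with end)
    (fun _ _ _ (f : False) _ => match f with end)
    (fun _ _ _ (f : False) _ => match f with end)).

Lemma empty_brauer_neq1 (X : Type) : X -> empty_brauer X <> 1.
Proof.
move=> x E; have : edge (1 : brauer X) (up x) (dn x) by exists x; left.
by rewrite -E => -[].
Qed.

Lemma slot_inj (X : Type) : infinite_set [set: X] ->
  exists slot : X + nat * vertex X -> X, injective slot.
Proof.
move=> /prod_nat_inj[e eI].
pose base (v : X + nat * vertex X) := match v with
  | inl z | inr (_, up z) | inr (_, dn z) => z
  end.
pose kind (v : X + nat * vertex X) : option (nat * bool) := match v with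
  | inl _ => None
  | inr (n, up _) => Some (n, true)
  | inr (n, dn _) => Some (n, false)
  end.
exists (fun v => e (base v, pickle (kind v))) => u v /eI[+ /(pcan_inj pickleK)].
by case: u v => [x|[m [x|x]]] [y|[n [y|y]]] //= -> // [->].
Qed.

Theorem theorem8p3 (X : Type) (hX : infinite_set [set: X]) :
  semigroup_Bergman (brauer X) /\ Sierpinski_rank (brauer X) = Some 2.
Proof.
have [x _] := infinite_setN0 hX.
have [slot slotI] := slot_inj hX.
have solve (t : nat -> brauer X) : exists a, forall n,
    a * shift slotI ^+ n * read slotI = t n.
  by exists (store slotI t) => n; exact: store_nth.
split; first exact: semigroup_Bergman_of solve.
exact: (Sierpinski_rank_of solve (@empty_brauer_neq1 X x)).
Qed.
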